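(* Let $f$ be an exponential family kernel with sufficient statistic of dimension $q\in\mathbb N$, i.e. $$f(x\mid\theta)=h(x)\exp\Big\{\sum_{i=1}^q\eta_i(\theta)T_i(x)-A(\theta)\Big\},\qquad x\in\mathcal X,\ \theta\in\Theta,$$ where $h:\mathcal X\to(0,\infty)$ is measurable, $T=(T_1,\ldots,T_q):\mathcal X\to\mathbb R^q$, $\eta=(\eta_1,\ldots,\eta_q):\Theta\to\mathbb R^q$ and $A:\Theta\to\mathbb R$. Suppose that $\eta$ and $A$ are infinitely differentiable on $\Theta^\circ$ and that $q<d_2$, where $\Theta\subset\mathbb R^{d_2}$. Then there exists a non-empty open set $U\subseteq\Theta^\circ$ on which $f$ satisfies a non-trivial parameter PDE.
   Context: Standing setting. The sample space $\mathcal X$ is a Borel subset of $\mathbb R^{d_1}$ with a $\sigma$-finite Borel measure $\lambda$ (understood to be Lebesgue measure for continuous kernels and counting measure for discrete ones). The parameter space $\Theta\subset\mathbb R^{d_2}$ is compact and equal to the closure of its interior $\Theta^\circ$, which is non-empty. A kernel is a jointly measurable function $f:\mathcal X\times\Theta\to[0,\infty)$, written $f(x\mid\theta)$, with $\int_{\mathcal X}f(x\mid\theta)\,\lambda(dx)=1$ for every $\theta\in\Theta$. In the exponential family, $T$ is the vector of sufficient statistics, $\eta$ the natural parameter map and $A$ the log-partition function. For a multi-index $\alpha\in\mathbb N_0^{d_2}$, $|\alpha|=\alpha_1+\cdots+\alpha_{d_2}$ and $\partial_\theta^\alpha=\partial^{|\alpha|}/\partial\theta_1^{\alpha_1}\cdots\partial\theta_{d_2}^{\alpha_{d_2}}$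 (the identity when $|\alpha|=0$). Parameter differential operator. For $U\subseteq\Theta^\circ$ open and $r\in\mathbb N_0$, a parameter differential operator on $U$ of order $r$ is a map $\mathcal L_\theta$ acting on functions $w\in C^r(U)$ by $\mathcal L_\theta w=\sum_{|\alpha|\le r}c_\alpha(\theta)\,\partial_\theta^\alpha w$, $\theta\in U$, with coefficients $c_\alpha\in C^{|\alpha|}(U)$. It is non-trivial on a set $A\subseteq U$ if $c_\alpha$ is not identically zero on $A$ for at least one $\alpha$ with $|\alpha|\ge 1$. The kernel $f$ satisfies a non-trivial parameter PDE on $U$ if there is a parameter differential operator $\mathcal L_\theta$ on $U$ of some order $r$, non-trivial on $U$, such that $\mathcal L_\theta f(x\mid\theta)=0$ for $\lambda$-almost every $x\in\mathcal X$ and every $\theta\in U$. *)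

(* Defs.v *)
From HB Require Import structures.
From mathcomp Require Import all_boot all_order all_algebra.
From mathcomp Require Import all_classical all_reals all_analysis.

Set Implicit Arguments.
Unset Strict Implicit.
Unset Printing Implicit Defensive.

Import Order.TTheory GRing.Theory Num.Theory.
Import numFieldNormedType.Exports.

Local Open Scope classical_set_scope.
Local Open Scope ring_scope.

(* Functions on a subset of R^n are represented by total functions on
   'rV[R]_n; every notion below only depends on their values on that subset.
   In particular, derivatives are only taken at points of open sets. *)

(* R^n with its Borel sigma-algebra. *)
Definition borel (R : realType) (n : nat) : Type :=
  g_sigma_algebraType (@open 'rV[R]_n).
HB.instance Definition _ (R : realType) (n : nat) :=
  Measurable.on (borel R n).

Section differential_operators.
Variables (R : realType) (n : nat).
Implicit Types (U A : set 'rV[R]_n) (w : 'rV[R]_n -> R).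

Definition partial (i : 'I_n) w : 'rV[R]_n -> R := 'D_(delta_mx ord0 i) w.

Fixpoint Ck (k : nat) U w : Prop :=
  (forall t, U t -> {for t, continuous w}) /\
  (if k is k'.+1 then
     forall i, (forall t, U t -> derivable w t (delta_mx ord0 i)) /\
               Ck k' U (partial i w)
   else True).

Definition smooth U w : Prop := forall k, Ck k U w.

Definition mdeg (a : 'I_n -> nat) : nat := \sum_(i < n) a i.

(* d_0^(a 0) (d_1^(a 1) (... (d_(n-1)^(a (n-1)) w))) *)
Definition mpartial (a : 'I_n -> nat) w : 'rV[R]_n -> R :=
  foldr (fun i g => iter (a i) (partial i) g) w (enum 'I_n).

(* A multi-index of degree at most r has all its entries at most r, so the
   a : mindex r with mdeg a <= r are exactly these multi-indices. The other
   elements of mindex r are ignored throughout. *)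
Definition mindex (r : nat) := {ffun 'I_n -> 'I_r.+1}.

Definition mindex_fun (r : nat) (a : mindex r) : 'I_n -> nat := fun i => a i.
Coercion mindex_fun : mindex >-> Funclass.

Definition pdo_coefs (r : nat) U (c : mindex r -> 'rV[R]_n -> R) : Prop :=
  forall a : mindex r, (mdeg a <= r)%N -> Ck (mdeg a) U (c a).

Definition pdo (r : nat) (c : mindex r -> 'rV[R]_n -> R) w
    : 'rV[R]_n -> R :=
  fun t => \sum_(a : mindex r | (mdeg a <= r)%N) c a t * mpartial a w t.

Definition pdo_nontrivial (r : nat) A (c : mindex r -> 'rV[R]_n -> R) : Prop :=
  exists a : mindex r, (1 <= mdeg a <= r)%N /\ exists2 t, A t & c a t != 0.

End differential_operators.

Section kernels.
Variables (R : realType) (d1 d2 : nat).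
Variables (X : set (borel R d1)) (lambda : {measure set (borel R d1) -> \bar R}).
Implicit Types (Theta U : set 'rV[R]_d2) (f : borel R d1 -> 'rV[R]_d2 -> R).

Definition is_kernel Theta f : Prop :=
  [/\ measurable_fun (X `*` (Theta : set (borel R d2)))
        (fun p : borel R d1 * borel R d2 => f p.1 p.2),
      forall x t, X x -> Theta t -> 0 <= f x t &
      forall t, Theta t -> (\int[lambda]_(x in X) (f x t)%:E = 1)%E].

(* The exceptional null set does not depend on t; the operator of order r is
   applied to f x only when f x is of class C^r on U. *)
Definition satisfies_nontrivial_pde U f : Prop :=
  exists (r : nat) (c : mindex d2 r -> 'rV[R]_d2 -> R),
    [/\ pdo_coefs U c, pdo_nontrivial U c &
        {ae lambda, forall x, X x ->
           Ck r U (f x) /\ forall t, U t -> pdo c (f x) t = 0}].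

End kernels.

(* Main.v *)
Require Import Defs.
From mathcomp Require Import all_boot all_order all_algebra.
From mathcomp Require Import all_classical all_reals all_analysis.

Set Implicit Arguments.
Unset Strict Implicit.
Unset Printing Implicit Defensive.

Import Order.TTheory GRing.Theory Num.Theory.
Import numFieldNormedType.Exports.

Local Open Scope classical_set_scope.
Local Open Scope ring_scope.

(** Since q < d2, at each t the q gradients of the eta_i span a proper subspace
of R^d2, so some direction v(t) is killed by all of them: v(t) *m J(t) = 0,
where J is the Jacobian of eta. Moving along v, log f(x | t) varies only
through the log-partition function, and this variation no longer depends on x:
[[
   sum_j v_j d_j f(x | t) = - (sum_j v_j d_j A(t)) * f(x | t).
]]
This is a parameter PDE of order one, valid for every x at once, with
first-order coefficients v_j and zeroth-order coefficient sum_j v_j d_j A.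

What remains is to choose v as a smooth function of t, which is where an open
set smaller than the interior of Theta comes in. Let t0 maximize the rank of J,
and fix a nonzero minor of J(t0) of that maximal size r, with rows rho and
columns kappa. Since r <= q < d2 there is a row j0 outside rho. Where the minor
stays nonzero, the rank of J is still r, so row j0 is a combination of the rows
rho, and Cramer's rule computes it; with denominators cleared this
combination is polynomial in the entries of J (cramer_row), hence smooth, and
its j0-th entry is the minor itself, hence nonzero. This is
tangent_kernel_field. The remaining regularity claims, for v and for f(x | t)
itself, reduce to the closure of the C^k functions on an open set under sums,
products, determinants and exponentials. *)

(** * Closure properties of C^k functions on an open set *)

Section Ck_closure.
Variables (R : realType) (n : nat) (U : set 'rV[R]_n).
Implicit Types (w : 'rV[R]_n -> R) (k : nat) (t : 'rV[R]_n).
Hypothesis oU : open U.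

(** Restricting w to the line through t in the direction v reduces this to
the chain rule in one variable. *)
Lemma is_derive_expR_comp w t v dw :
  is_derive t v w dw ->
  is_derive t v (fun s => expR (w s)) (expR (w t) * dw).
Proof.
move=> [dwt <-].
pose g (s : R) := w (s *: v + t).
have dg : derivable g 0 1 by case: (derivable1P w t v) => + _; exact.
have dexp : derivable (expR \o g) 0 1.
  by apply/derivable1_diffP/differentiable_comp; apply/derivable1_diffP.
have along u : 'D_v u t = 'D_1 (fun s : R => u (s *: v + t)) 0.
  rewrite /derive; set d1 := fun _ => _; set d2 := fun _ => _.
  suff -> : d1 = d2 by [].
  by apply/funext => s; rewrite /d1 /d2 /= addr0 scale0r add0r [_%:A]mulr1.
apply: DeriveDef.
  by case: (derivable1P (fun s => expR (w s)) t v) => _; exact.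
rewrite [LHS]along -derive1E (_ : (fun _ => _) = expR \o g)//.
rewrite (derive1_comp dg (@derivable_expR _ _)).
rewrite !derive1E along; congr (_ * _).
by rewrite derive_val /g scale0r add0r.
Qed.

Lemma CkW k w : Ck k.+1 U w -> Ck k U w.
Proof.
elim: k w => [|k IH] w [cw dw]; split=> //.
by move=> i; have [? /IH] := dw i.
Qed.

Lemma Ck_continuous k w : Ck k U w -> forall t, U t -> {for t, continuous w}.
Proof. by case: k => [|k] []. Qed.

Lemma Ck_is_derive k w i t : Ck k.+1 U w -> U t ->
  is_derive t (delta_mx ord0 i) w (partial i w t).
Proof. by case=> _ /(_ i)[dw _] /dw; exact: derivableP. Qed.

Lemma near_eq_on w w' t : {in U, w =1 w'} -> U t -> \near t, w t = w' t.
Proof.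
move=> ww' Ut; have := open_nbhs_nbhs (conj oU Ut).
by apply: filterS => s Us; apply: ww'; rewrite inE.
Qed.

(** Continuity and derivatives at a point of the open set U only see values on
U. This lets the derivatives in Ck be replaced by formulas valid on U only. *)
Lemma eq_Ck k w w' : {in U, w =1 w'} -> Ck k U w -> Ck k U w'.
Proof.
have cont (u u' : 'rV[R]_n -> R) : {in U, u =1 u'} ->
    (forall t, U t -> {for t, continuous u}) ->
    forall t, U t -> {for t, continuous u'}.
  move=> uu' cu t Ut; rewrite /prop_for /continuous_at -(uu' t) ?inE//.
  apply: cvg_trans (cu t Ut); apply: (@near_eq_cvg _ _ (nbhs t)).
  exact: near_eq_on.
elim: k w w' => [|k IH] w w' ww' [cw dw]; split=> //; try exact: cont ww' cw.
move=> i; have [dwi Cwi] := dw i; split.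
  by move=> t Ut; apply: near_eq_derivable (dwi _ Ut); exact: near_eq_on.
apply: IH Cwi => t; rewrite inE => Ut; apply: near_eq_derive.
exact: near_eq_on.
Qed.

(** Introduction rule for one more degree of differentiability: the candidate
derivatives dw only need to be correct on U. *)
Lemma CkS_intro k w (dw : 'I_n -> 'rV[R]_n -> R) :
  (forall t, U t -> {for t, continuous w}) ->
  (forall i t, U t -> is_derive t (delta_mx ord0 i) w (dw i t)) ->
  (forall i, Ck k U (dw i)) -> Ck k.+1 U w.
Proof.
move=> cw dwP Cdw; split=> // i; split.
  by move=> t /(dwP i) [].
apply: eq_Ck (Cdw i) => t; rewrite inE => /(dwP i) dwt.
by rewrite /partial derive_val.
Qed.

Lemma Ck_cst k (a : R) : Ck k U (fun=> a).
Proof.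
elim: k a => [|k IH] a.
  by split=> // t _; exact: cst_continuous.
apply: (@CkS_intro _ _ (fun _ _ => 0)).
- by move=> t _; exact: cst_continuous.
- by move=> i; exact: IH.
Qed.

Lemma CkD k w w' : Ck k U w -> Ck k U w' -> Ck k U (fun t => w t + w' t).
Proof.
elim: k w w' => [|k IH] w w' Cw Cw'.
  split=> // t Ut.
  exact: continuousD (Ck_continuous Cw Ut) (Ck_continuous Cw' Ut).
apply: (@CkS_intro _ _ (fun i t => partial i w t + partial i w' t)).
- move=> t Ut.
  exact: continuousD (Ck_continuous Cw Ut) (Ck_continuous Cw' Ut).
- move=> i t Ut.
  exact: (is_deriveD (Ck_is_derive i Cw Ut) (Ck_is_derive i Cw' Ut)).
- by move=> i; apply: IH; [have [_ /(_ i)[]] := Cw|have [_ /(_ i)[]] := Cw'].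
Qed.

Lemma CkM k w w' : Ck k U w -> Ck k U w' -> Ck k U (fun t => w t * w' t).
Proof.
elim: k w w' => [|k IH] w w' Cw Cw'.
  split=> // t Ut.
  exact: continuousM (Ck_continuous Cw Ut) (Ck_continuous Cw' Ut).
apply: (@CkS_intro _ _
  (fun i t => w t * partial i w' t + w' t * partial i w t)).
- move=> t Ut.
  exact: continuousM (Ck_continuous Cw Ut) (Ck_continuous Cw' Ut).
- move=> i t Ut.
  exact: (is_deriveM (Ck_is_derive i Cw Ut) (Ck_is_derive i Cw' Ut)).
- move=> i; have [_ /(_ i)[_ Cdw]] := Cw; have [_ /(_ i)[_ Cdw']] := Cw'.
  by apply: CkD; apply: IH => //; exact: CkW.
Qed.

Lemma CkN k w : Ck k U w -> Ck k U (fun t => - w t).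
Proof.
move=> Cw; apply: (@eq_Ck _ (fun t => -1 * w t)) => [t _|].
  by rewrite mulN1r.
by apply: CkM => //; exact: Ck_cst.
Qed.

Lemma CkB k w w' : Ck k U w -> Ck k U w' -> Ck k U (fun t => w t - w' t).
Proof. by move=> Cw Cw'; apply: CkD => //; exact: CkN. Qed.

Lemma Ck_sum k (I : Type) (r : seq I) (P : pred I) (F : I -> 'rV[R]_n -> R) :
  (forall i, P i -> Ck k U (F i)) ->
  Ck k U (fun t => \sum_(i <- r | P i) F i t).
Proof.
move=> CF; elim: r => [|i r IH].
  by under eq_fun do rewrite big_nil; exact: Ck_cst.
under eq_fun do rewrite big_cons.
by case: (P i) (CF i) => // CFi; apply: CkD => //; exact: CFi.
Qed.

Lemma Ck_prod k (I : Type) (r : seq I) (P : pred I) (F : I -> 'rV[R]_n -> R) :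
  (forall i, P i -> Ck k U (F i)) ->
  Ck k U (fun t => \prod_(i <- r | P i) F i t).
Proof.
move=> CF; elim: r => [|i r IH].
  by under eq_fun do rewrite big_nil; exact: Ck_cst.
under eq_fun do rewrite big_cons.
by case: (P i) (CF i) => // CFi; apply: CkM => //; exact: CFi.
Qed.

Lemma Ck_expR k w : Ck k U w -> Ck k U (fun t => expR (w t)).
Proof.
have cexp k' w' : Ck k' U w' ->
    forall t, U t -> {for t, continuous (fun t => expR (w' t))}.
  move=> Cw' t Ut.
  exact: (continuous_comp (Ck_continuous Cw' Ut) (@continuous_expR R (w' t))).
elim: k w => [|k IH] w Cw; first by split=> //; exact: cexp Cw.
apply: (@CkS_intro _ _ (fun i t => expR (w t) * partial i w t)).
- exact: cexp Cw.
- by move=> i t Ut; apply: is_derive_expR_comp; exact: Ck_is_derive Cw Ut.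
- move=> i; apply: CkM; first exact/IH/CkW.
  by have [_ /(_ i)[]] := Cw.
Qed.

Lemma Ck_det k m (M : 'rV[R]_n -> 'M[R]_m) :
  (forall i j, Ck k U (fun t => M t i j)) -> Ck k U (fun t => \det (M t)).
Proof.
move=> CM; apply: Ck_sum => s _; apply: CkM; first exact: Ck_cst.
by apply: Ck_prod => i _.
Qed.

Lemma Ck_adj k m (M : 'rV[R]_n -> 'M[R]_m) i j :
  (forall i j, Ck k U (fun t => M t i j)) ->
  Ck k U (fun t => (\adj (M t)) i j).
Proof.
move=> CM; under eq_fun do rewrite mxE.
apply: CkM; first exact: Ck_cst.
apply: Ck_det => a b; under eq_fun do rewrite !mxE.
exact: CM.
Qed.

Lemma Ck_mulmx k a b c (M : 'rV[R]_n -> 'M[R]_(a, b))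
    (N : 'rV[R]_n -> 'M[R]_(b, c)) i j :
  (forall i j, Ck k U (fun t => M t i j)) ->
  (forall i j, Ck k U (fun t => N t i j)) ->
  Ck k U (fun t => (M t *m N t) i j).
Proof.
move=> CM CN; under eq_fun do rewrite mxE.
by apply: Ck_sum => l _; apply: CkM.
Qed.

End Ck_closure.

(** * Kernel vectors given by Cramer's rule *)

Section cramer_row.
Variables (F : fieldType) (m n r : nat).
Variables (rho : 'I_r -> 'I_m) (kappa : 'I_r -> 'I_n) (j0 : 'I_m).
Implicit Types J : 'M[F]_(m, n).

(** The coefficients of the relation det M * J_j0 = J_j0,kappa * adj M * J_rho
between row j0 and the rows rho, where M is the submatrix of the minor. Using
the adjugate rather than the inverse of M makes the entries polynomial in those
of J. *)
Definition cramer_row J : 'rV[F]_m :=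
  \det (mxsub rho kappa J) *: delta_mx 0 j0
  - row j0 (colsub kappa J) *m \adj (mxsub rho kappa J) *m rowsub rho 1%:M.

(** The rows rho are independent and, by the bound on the rank, span the row
space of J. So J_j0 = w * J_rho for some w, whence J_j0,kappa = w * M, and
M * adj M = det M turns both terms of the product into det M * w * J_rho. *)
Lemma cramer_row_mul J : (\rank J <= r)%N ->
  \det (mxsub rho kappa J) != 0 -> cramer_row J *m J = 0.
Proof.
move=> rJ detM; set M := mxsub rho kappa J in detM *.
have rankM : \rank M = r by apply: mxrank_unit; rewrite unitmxE unitfE.
have rankJr : (r <= \rank (rowsub rho J))%N.
  have defM : M = rowsub rho J *m colsub kappa 1%:M.
    by rewrite mulmx_colsub mulmx1 -mxsubcr.
  by rewrite -[X in (X <= _)%N]rankM defM mxrankM_maxl.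
have subJ : (rowsub rho J <= J)%MS by rewrite rowsubE submxMl.
have /submxP[w rowJ] : (row j0 J <= rowsub rho J)%MS.
  apply: submx_trans (row_sub _ _) _.
  rewrite -(mxrank_leqif_sup subJ) eqn_leq mxrankS//=.
  exact: leq_trans rankJr.
have rowJk : row j0 (colsub kappa J) = w *m M.
  rewrite (mxsubcr rho kappa J : M = _) mulmx_colsub -rowJ.
  by apply/rowP => i; rewrite !mxE.
rewrite /cramer_row -/M rowJk mulmxBl -!mulmxA mul_rowsub_mx mul1mx.
rewrite [M *m _]mulmxA mul_mx_adj mul_scalar_mx -scalemxAr -rowJ.
by rewrite -scalemxAl -rowE subrr.
Qed.

Lemma cramer_row_pivot J : (forall i, rho i != j0) ->
  cramer_row J 0 j0 = \det (mxsub rho kappa J).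
Proof.
move=> rhoj0; rewrite !mxE !eqxx mulr1 big1 ?subr0// => i _.
by rewrite !mxE (negbTE (rhoj0 i)) mulr0.
Qed.

End cramer_row.

Lemma rank_minor_exists (F : fieldType) (m n : nat) (J : 'M[F]_(m, n)) :
  exists (rho : 'I_(\rank J) -> 'I_m) (kappa : 'I_(\rank J) -> 'I_n),
    \det (mxsub rho kappa J) != 0.
Proof.
pose rho := maxrankfun J.
have fullT : row_full (rowsub rho J)^T.
  by rewrite /row_full mxrank_tr; exact: maxrowsub_free.
exists rho, (fullrankfun fullT).
rewrite -unitfE -unitmxE -unitmx_tr.
have -> : (mxsub rho (fullrankfun fullT) J)^T =
    rowsub (fullrankfun fullT) (rowsub rho J)^T.
  by apply/matrixP => i j; rewrite !mxE.
exact: fullrowsub_unit.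
Qed.

(** Maximality is what bounds the rank of J near t0, where the nonvanishing of
one minor only bounds it from below. *)
Lemma max_rank_point (F : fieldType) (S : Type) (m n : nat) (D : set S)
    (J : S -> 'M[F]_(m, n)) : D !=set0 ->
  exists2 t0, D t0 & forall t, D t -> (\rank (J t) <= \rank (J t0))%N.
Proof.
move=> [t1 Dt1].
pose P k := `[< exists2 t, D t & \rank (J t) = k >].
have exP : exists k, P k by exists (\rank (J t1)); apply/asboolP; exists t1.
have ubP k : P k -> (k <= m)%N by move=> /asboolP[t _ <-]; exact: rank_leq_row.
case: (ex_maxnP exP ubP) => k /asboolP[t0 Dt0 <-] kmax.
by exists t0 => // t Dt; apply: kmax; apply/asboolP; exists t.
Qed.

(** * First-order parameter differential operators *)

Section first_order.
Variables (R : realType) (n : nat).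
Implicit Types (w c : 'rV[R]_n -> R) (v : 'rV[R]_n -> 'rV[R]_n).
Implicit Types t : 'rV[R]_n.

Definition mindex0 : mindex n 1 := [ffun=> ord0].
Definition mindex1 (j : 'I_n) : mindex n 1 := [ffun i => inord (i == j)].

Lemma mindex0E i : mindex0 i = 0%N :> nat.
Proof. by rewrite /mindex_fun ffunE. Qed.

Lemma mindex1E j i : mindex1 j i = (i == j) :> nat.
Proof. by rewrite /mindex_fun ffunE inordK//; case: eqP. Qed.

Lemma mdeg0 : mdeg mindex0 = 0%N.
Proof. by rewrite /mdeg big1// => i _; rewrite mindex0E. Qed.

Lemma mdeg1 j : mdeg (mindex1 j) = 1%N.
Proof.
rewrite /mdeg (bigD1 j)//= mindex1E eqxx big1 ?addn0// => i /negbTE ij.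
by rewrite mindex1E ij.
Qed.

Lemma mdeg_eq0 (a : mindex n 1) : mdeg a = 0%N -> a = mindex0.
Proof.
move=> /eqP; rewrite sum_nat_eq0 => /forallP a0.
by apply/ffunP => i; apply: val_inj; have /eqP /= := a0 i; rewrite ffunE.
Qed.

Lemma mdeg_eq1 (a : mindex n 1) : mdeg a = 1%N -> exists j, a = mindex1 j.
Proof.
move=> /eqP /sum_nat_eq1[j [_ aj aN]]; exists j; apply/ffunP => i.
apply: val_inj => /=; rewrite -[RHS]/(mindex1 j i : nat) mindex1E.
by have [->//|/aN] := eqVneq i j; exact.
Qed.

Lemma mpartial0 w : mpartial mindex0 w = w.
Proof.
rewrite /mpartial; elim: (enum _) => //= i s ->.
by rewrite mindex0E.
Qed.

Lemma mpartial1 j w : mpartial (mindex1 j) w = partial j w.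
Proof.
rewrite /mpartial.
have : j \in enum 'I_n by rewrite mem_enum.
have := enum_uniq 'I_n; elim: (enum _) => //= i s IH /andP[iNs us].
rewrite inE mindex1E => /orP[/eqP ji|js]; last first.
  by rewrite IH//; case: eqVneq => // ij; rewrite ij js in iNs.
rewrite -ji eqxx /=; rewrite -ji in iNs; congr partial.
elim: s iNs {us IH} => //= l s IH; rewrite inE negb_or => /andP[jl js].
by rewrite IH// mindex1E eq_sym (negbTE jl).
Qed.

(** The multi-indices of degree at most one are 0 and the unit ones, the latter
being reindexed by the position of their nonzero entry. *)
Lemma pdo1E (coef : mindex n 1 -> 'rV[R]_n -> R) w t :
  pdo coef w t =
    coef mindex0 t * w t + \sum_j coef (mindex1 j) t * partial j w t.
Proof.
rewrite /pdo (bigD1 mindex0) ?mdeg0//= mpartial0; congr (_ + _).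
rewrite (eq_bigl (fun a : mindex n 1 => mdeg a == 1%N)); last first.
  move=> a; rewrite leq_eqVlt ltnS leqn0.
  have [->|a0] := eqVneq a mindex0; first by rewrite mdeg0.
  rewrite andbT; case: (mdeg a =P 0%N) => [/mdeg_eq0 /eqP|_].
    by rewrite (negbTE a0).
  by rewrite orbF.
(* The inverse pos of the reindexing needs a default value: n = 0 is apart. *)
case: (pickP 'I_n) => [j0 _|no]; last first.
  rewrite big1 => [|a /eqP/mdeg_eq1[j]]; last by have := no j.
  by rewrite big1 // => j; have := no j.
pose pos (a : mindex n 1) := odflt j0 [pick j | a == mindex1 j].
have mindex1_inj : injective mindex1.
  move=> i j ij; apply/eqP; have := mindex1E j i.
  by rewrite -ij mindex1E eqxx; case: eqP.
rewrite (reindex_onto mindex1 pos) => [|a /eqP/mdeg_eq1[j ->]]; last first.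
  by rewrite /pos; case: pickP => [i /eqP <-//|/(_ j)]; rewrite eqxx.
apply: eq_big => [j|j _]; last by rewrite mpartial1.
rewrite mdeg1 eqxx /pos; case: pickP => [i /eqP /mindex1_inj ->|/(_ j)] /=.
  by rewrite eqxx.
by rewrite eqxx.
Qed.

(** The coefficients of w |-> c * w + sum_j v_j * d_j w; at a multi-index of
degree one the sum below selects the single relevant v_j. *)
Definition first_order c v (a : mindex n 1) t : R :=
  if mdeg a == 0%N then c t else \sum_j (a j)%:R * v t 0 j.

Lemma first_order0 c v : first_order c v mindex0 = c.
Proof. by apply/funext => t; rewrite /first_order mdeg0. Qed.

Lemma first_order1 c v j : first_order c v (mindex1 j) = (fun t => v t 0 j).
Proof.
apply/funext => t; rewrite /first_order mdeg1/= (bigD1 j)//= mindex1E eqxx.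
by rewrite mul1r big1 ?addr0// => i /negbTE ij; rewrite mindex1E ij mul0r.
Qed.

Lemma first_order_coefs (U : set 'rV[R]_n) c v : Ck 0 U c ->
  (forall j, Ck 1 U (fun t => v t 0 j)) -> pdo_coefs U (first_order c v).
Proof.
move=> Cc Cv a; rewrite leq_eqVlt ltnS leqn0.
move=> /orP[/eqP/mdeg_eq1[j ->]|/eqP/mdeg_eq0 ->].
  by rewrite mdeg1 first_order1; exact: Cv.
by rewrite mdeg0 first_order0.
Qed.

Lemma first_order_nontrivial (U : set 'rV[R]_n) c v t j :
  U t -> v t 0 j != 0 -> pdo_nontrivial U (first_order c v).
Proof.
move=> Ut vtj; exists (mindex1 j); rewrite mdeg1 first_order1.
by split=> //; exists t.
Qed.

End first_order.

(** * A smooth field of directions annihilated by the Jacobian *)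

(** Row j holds the partial derivatives in direction j, so that row vectors of
directions act on the left. *)
Definition jacobian (R : realType) (n q : nat) (eta : 'rV[R]_n -> 'rV[R]_q)
    (t : 'rV[R]_n) : 'M[R]_(n, q) :=
  \matrix_(j, i) partial j (fun s => eta s ord0 i) t.

Lemma smooth_partial (R : realType) (n : nat) (U : set 'rV[R]_n) w i :
  smooth U w -> smooth U (partial i w).
Proof. by move=> sw k; have [_ /(_ i)[]] := sw k.+1. Qed.

Lemma Ck_subset (R : realType) (n : nat) (U V : set 'rV[R]_n) k w :
  U `<=` V -> Ck k V w -> Ck k U w.
Proof.
move=> UV; elim: k w => [|k IH] w [cw dw]; split=> //.
- by move=> t /UV; exact: cw.
- by move=> t /UV; exact: cw.
by move=> i; have [dwi /IH ?] := dw i; split=> // t /UV; exact: dwi.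
Qed.

(** The Cramer vector built on a maximal minor at a point of maximal rank, on
the neighbourhood where this minor does not vanish. *)
Lemma tangent_kernel_field (R : realType) (n q : nat) (D : set 'rV[R]_n)
    (eta : 'rV[R]_n -> 'rV[R]_q) :
  open D -> D !=set0 -> (forall i, smooth D (fun t => eta t ord0 i)) ->
  (q < n)%N ->
  exists (U : set 'rV[R]_n) (v : 'rV[R]_n -> 'rV[R]_n),
    [/\ open U, U `<=` D, (forall j, smooth U (fun t => v t 0 j)),
        (exists2 t, U t & exists j, v t 0 j != 0) &
        forall t, U t -> v t *m jacobian eta t = 0].
Proof.
move=> oD D0 eta_smooth q_lt.
have [t0 Dt0 rank_max] := max_rank_point (jacobian eta) D0.
have [rho [kappa minor0]] := rank_minor_exists (jacobian eta t0).
(* There are at most q < n rows in rho. *)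
have [j0 j0rho] : exists j0, j0 \notin codom rho.
  have /subsetPn[j0 _] : ~~ ('I_n \subset codom rho); last by exists j0.
  apply: contraL q_lt => /subset_leq_card; rewrite card_ord -leqNgt => le_n.
  apply: leq_trans le_n _; apply: leq_trans (card_size _) _.
  by rewrite size_codom card_ord rank_leq_col.
have j0P i : rho i != j0 by apply: contraNneq j0rho => <-; exact: codom_f.
have CJ k i j : Ck k D (fun t => jacobian eta t i j).
  under eq_fun do rewrite mxE.
  exact: smooth_partial (eta_smooth j) k.
pose minor t := \det (mxsub rho kappa (jacobian eta t)).
have Cminor k : Ck k D minor.
  by apply: Ck_det => // i j; under eq_fun do rewrite mxE; exact: CJ.
pose v t := cramer_row rho kappa j0 (jacobian eta t).
have Cv k j : Ck k D (fun t => v t 0 j).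
  under eq_fun do rewrite /v /cramer_row mxE [X in X + _]mxE [X in _ + X]mxE.
  apply: CkB => //; first by apply: CkM => //; exact: Ck_cst.
  apply: Ck_mulmx => // a b; last exact: Ck_cst.
  apply: Ck_mulmx => // {}a {}b.
    by under eq_fun do rewrite 2!mxE; exact: CJ.
  by apply: Ck_adj => // x y; under eq_fun do rewrite mxE; exact: CJ.
pose U := D `&` [set t | minor t != 0]°.
have UD : U `<=` D by move=> t [].
exists U, v; split=> //.
- by apply: openI => //; exact: open_interior.
- by move=> j k; exact: Ck_subset UD _.
- exists t0; last by exists j0; rewrite /v cramer_row_pivot.
  split=> //; rewrite /interior /=.
  have /= := Ck_continuous (Cminor 0%N) Dt0.
  by move=> /(_ [set x | x != 0]); apply; exact: open_nbhs_nbhs.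
- move=> t [Dt /interior_subset mt].
  by rewrite /v cramer_row_mul//; exact: rank_max.
Qed.

(** * The parameter PDE of an exponential family *)

Theorem proposition1 (R : realType) (d1 d2 q : nat)
    (X : set (borel R d1)) (mX : measurable X)
    (lambda : {measure set (borel R d1) -> \bar R})
    (lambda_sfin : sigma_finite X lambda)
    (Theta : set 'rV[R]_d2)
    (Theta_compact : compact Theta)
    (Theta_regular : Theta = closure (interior Theta))
    (Theta_int : interior Theta !=set0)
    (f : borel R d1 -> 'rV[R]_d2 -> R)
    (f_kernel : is_kernel X lambda Theta f)
    (h : borel R d1 -> R) (T : borel R d1 -> 'rV[R]_q)
    (eta : 'rV[R]_d2 -> 'rV[R]_q) (A : 'rV[R]_d2 -> R)
    (h_gt0 : forall x, X x -> 0 < h x)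
    (h_meas : measurable_fun X h)
    (f_expfam : forall x t, X x -> Theta t ->
       f x t = h x * expR (\sum_(i < q) eta t ord0 i * T x ord0 i - A t))
    (eta_smooth : forall i : 'I_q,
       smooth (interior Theta) (fun t => eta t ord0 i))
    (A_smooth : smooth (interior Theta) A)
    (q_gt0 : (0 < q)%N) (q_lt : (q < d2)%N) :
  exists U : set 'rV[R]_d2,
    [/\ open U, U !=set0, U `<=` interior Theta &
        satisfies_nontrivial_pde X lambda U f].
Proof.
have [U [v [oU UD Cv [t1 Ut1 [j1 v1]] vJ]]] :=
  tangent_kernel_field (open_interior Theta) Theta_int eta_smooth q_lt.
exists U; split=> //; first by exists t1.
have CA k : Ck k U A by exact: Ck_subset UD (A_smooth k).
have Ceta k i : Ck k U (fun t => eta t ord0 i).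
  exact: Ck_subset UD (eta_smooth i k).
pose c t := \sum_j v t 0 j * partial j A t.
exists 1%N, (first_order c v); split.
- apply: first_order_coefs => // [|j]; last exact: Cv.
  apply: Ck_sum => // j _; apply: CkM => //; first exact: Cv.
  by have [_ /(_ j)[]] := CA 1%N.
- exact: first_order_nontrivial Ut1 v1.
apply: aeW => x Xx.
pose phi t := \sum_(i < q) eta t ord0 i * T x ord0 i - A t.
have Cphi : Ck 1 U phi.
  apply: CkB => //; apply: Ck_sum => // i _; apply: CkM => //.
  exact: Ck_cst.
have fE : {in U, (fun t => h x * expR (phi t)) =1 f x}.
  move=> t; rewrite inE => Ut; rewrite f_expfam//.
  exact: interior_subset (UD _ Ut).
have dphi t j : U t -> partial j phi t =
    \sum_i jacobian eta t j i * T x ord0 i - partial j A t.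
  move=> Ut.
  have deta i : is_derive t (delta_mx ord0 j)
      (fun s => eta s ord0 i * T x ord0 i)
      (jacobian eta t j i * T x ord0 i).
    have := is_deriveM (Ck_is_derive j (Ceta 1%N i) Ut)
      (is_derive_cst (T x ord0 i) t (delta_mx ord0 j)).
    move=> /is_derive_eq; apply.
    by rewrite scaler0 add0r mxE [RHS]mulrC.
  have := is_deriveB (is_derive_sum deta) (Ck_is_derive j (CA 1%N) Ut).
  by rewrite fct_sumE => -[].
have df t j : U t -> partial j (f x) t = f x t * partial j phi t.
  move=> Ut.
  have ef : \near t, h x * expR (phi t) = f x t by exact: near_eq_on fE Ut.
  rewrite /partial -(near_eq_derive _ ef) -(fE t) ?inE//.
  have := is_deriveZ (h x) (is_derive_expR_comp (Ck_is_derive j Cphi Ut)).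
  by rewrite -mulrA => -[].
split.
  apply: eq_Ck fE _ => //; apply: CkM => //; first exact: Ck_cst.
  exact: Ck_expR.
move=> t Ut; rewrite pdo1E first_order0.
under eq_bigr => j _ do rewrite first_order1 df// dphi//.
(* The coefficients of the T_i x in sum_j v_j d_j phi form v *m J = 0. *)
have vT : \sum_j v t 0 j * \sum_i jacobian eta t j i * T x ord0 i = 0.
  transitivity ((v t *m jacobian eta t *m (T x)^T) 0 0); last first.
    by rewrite vJ// mul0mx mxE.
  rewrite -mulmxA mxE; apply: eq_bigr => j _; rewrite [in RHS]mxE.
  by congr (_ * _); apply: eq_bigr => i _; rewrite [_^T _ _]mxE.
rewrite (eq_bigr (fun j =>
    f x t * (v t 0 j * \sum_i jacobian eta t j i * T x ord0 i)
    - f x t * (v t 0 j * partial j A t))); last first.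
  by move=> j _; rewrite mulrCA mulrBr mulrBr.
by rewrite sumrB -!mulr_sumr vT mulr0 sub0r /c mulrC subrr.
Qed.
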